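(* Let $\mathcal{H}$ be a real Hilbert space, let $\alpha>0$, $\beta>0$, $\rho\in\,]0,\alpha^{-1}]$, let $\mathcal{A}\colon\mathcal{H}\to\mathcal{H}$ be $\alpha$-cocoercive and $\rho$-strongly monotone, and let $\mathcal{B}\colon\mathcal{H}\to\mathcal{H}$ be $\beta$-cocoercive. Assume that there exists $x\in\mathcal{H}$ with $\mathcal{A}x+\mathcal{B}x=0$. Let $\tau>0$. Then the following hold. 1. Suppose that $\tau\in\,]0,2\beta\alpha/(\beta+\alpha)[$. Then $G_{\tau(\mathcal{A}+\mathcal{B})}$ is $\omega_G(\tau)$-Lipschitz continuous, where $$\omega_G(\tau):=\sqrt{1-\frac{2\tau\rho}{\alpha(2\beta-\tau)}\big(2\beta\alpha-\tau(\beta+\alpha)\big)}\in\,]0,1[.$$ In particular, the minimum of $\omega_G$ over $]0,2\beta\alpha/(\beta+\alpha)[$ is achieved at $$\tau^*=\frac{2\beta\alpha}{\sqrt{\beta+\alpha}\,(\sqrt{\beta+\alpha}+\sqrt{\beta})}\quad\text{and}\quad \omega_G(\tau^* )=\sqrt{1-\frac{4\rho\beta\alpha}{(\sqrt{\beta+\alpha}+\sqrt{\beta})^2}}.$$ 2. Suppose that $\tau\in\,]0,2\alpha[$. Then $T_{\tau\mathcal{B},\tau\mathcal{A}}$ is $\omega_{T_1}(\tau)$-Lipschitz continuous, where $$\omega_{T_1}(\tau):=\sqrt{1-\frac{\tau\rho}{\alpha}(2\alpha-\tau)}\in\,]0,1[.$$ In particular, the minimum of $\omega_{T_1}$ over $]0,2\alpha[$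 is achieved at $\tau^*=\alpha$ and $\omega_{T_1}(\tau^* )=\sqrt{1-\alpha\rho}$. 3. Suppose that $\tau\in\,]0,2\beta]$. Then $T_{\tau\mathcal{A},\tau\mathcal{B}}$ is $\omega_{T_2}(\tau)$-Lipschitz continuous, where $$\omega_{T_2}(\tau):=\frac{1}{1+\tau\rho}\in\,]0,1[.$$ In particular, the minimum of $\omega_{T_2}$ over $]0,2\beta]$ is achieved at $\tau^*=2\beta$ and $\omega_{T_2}(\tau^* )=\frac{1}{1+2\beta\rho}$. 4. $R_{\tau\mathcal{B},\tau\mathcal{A}}$ and $R_{\tau\mathcal{A},\tau\mathcal{B}}$ are $\omega_R(\tau)$-Lipschitz continuous, where $$\omega_R(\tau)=\sqrt{\frac{\alpha-2\tau\rho\alpha+\tau^2\rho}{\alpha+2\tau\rho\alpha+\tau^2\rho}}\in\,]0,1[.$$ In particular, the minimum of $\omega_R$ over $]0,+\infty[$ is achieved at $\tau^*=\sqrt{\alpha/\rho}$ and $\omega_R(\tau^* )=\sqrt{\frac{1-\sqrt{\alpha\rho}}{1+\sqrt{\alpha\rho}}}$. 5. $S_{\tau\mathcal{B},\tau\mathcal{A}}$ and $S_{\tau\mathcal{A},\tau\mathcal{B}}$ are $\omega_S(\tau)$-Lipschitz continuous, where $$\omega_S(\tau)=\min\left\{\frac{1+\omega_R(\tau)}{2},\ \frac{\beta+\tau^2\rho}{\beta+\tau\beta\rho+\tau^2\rho}\right\}\in\,]0,1[.$$ In particular, the minimum of $\omega_S$ over $]0,+\infty[$ is achieved at $$\tau^*=\begin{cases}\sqrt{\alpha/\rho},&\text{if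 }\beta\le\frac{4\alpha}{(1+\sqrt{1-\alpha\rho})^2};\\ \sqrt{\beta/\rho},&\text{otherwise,}\end{cases}\quad\text{and}\quad \omega_S(\tau^* )=\begin{cases}\frac{1+\sqrt{1-\alpha\rho}}{1+\sqrt{1-\alpha\rho}+\sqrt{\alpha\rho}},&\text{if }\beta\le\frac{4\alpha}{(1+\sqrt{1-\alpha\rho})^2};\\ \frac{2}{2+\sqrt{\beta\rho}},&\text{otherwise.}\end{cases}$$
   Context: An operator $\mathcal{M}\colon\mathcal{H}\to\mathcal{H}$ is $\eta$-cocoercive ($\eta>0$) if $\langle \mathcal{M}x-\mathcal{M}y\mid x-y\rangle\ge\eta\|\mathcal{M}x-\mathcal{M}y\|^2$ for all $x,y\in\mathcal{H}$, and $\rho$-strongly monotone ($\rho>0$) if $\langle \mathcal{M}x-\mathcal{M}y\mid x-y\rangle\ge\rho\|x-y\|^2$ for all $x,y\in\mathcal{H}$. An operator $\Phi\colon\mathcal{H}\to\mathcal{H}$ is $\omega$-Lipschitz continuous ($\omega\ge 0$) if $\|\Phi x-\Phi y\|\le\omega\|x-y\|$ for all $x,y\in\mathcal{H}$. $\mathrm{Id}$ is the identity operator on $\mathcal{H}$. Cocoercive operators are maximally monotone, so for such $\mathcal{M}$ and $\tau>0$ the resolvent $J_{\tau\mathcal{M}}=(\mathrm{Id}+\tau\mathcal{M})^{-1}\colon\mathcal{H}\to\mathcal{H}$ is single-valued and everywhere defined. For cocoercive operators $\mathcal{M},\mathcal{N}$ on $\mathcal{H}$ and $\tau>0$ define - $G_{\tau\mathcal{M}}=\mathrm{Id}-\tau\mathcal{M}$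 (explicit operator); - $T_{\tau\mathcal{N},\tau\mathcal{M}}=J_{\tau\mathcal{N}}\circ G_{\tau\mathcal{M}}$ (forward-backward operator); - $R_{\tau\mathcal{N},\tau\mathcal{M}}=(2J_{\tau\mathcal{N}}-\mathrm{Id})\circ(2J_{\tau\mathcal{M}}-\mathrm{Id})$ (Peaceman-Rachford operator); - $S_{\tau\mathcal{N},\tau\mathcal{M}}=\frac{1}{2}\big(\mathrm{Id}+R_{\tau\mathcal{N},\tau\mathcal{M}}\big)$ (Douglas-Rachford operator).
   Formalization: In items 2 and 4 the rates ω_{T_1}(τ) and ω_R(τ) equal 0 when ρ=1/α and τ=α (e.g. A=α^{-1}Id), so membership in ]0,1[ is claimed only outside that case; in that case it is replaced by membership in [0,1[. *)

(* Defs.v *)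
From HB Require Import structures.
From mathcomp Require Import all_boot all_order all_algebra.
From mathcomp Require Import all_classical all_reals all_analysis.

Set Implicit Arguments.
Unset Strict Implicit.
Unset Printing Implicit Defensive.

Import Order.TTheory GRing.Theory Num.Theory.
Import numFieldNormedType.Exports.

Local Open Scope classical_set_scope.
Local Open Scope ring_scope.

Definition cocoercive (R : realType) (H : normedModType R)
    (dot : H -> H -> R) (eta : R) (M : H -> H) : Prop :=
  forall x y : H, dot (M x - M y) (x - y) >= eta * `|M x - M y| ^+ 2.

Definition strongly_monotone (R : realType) (H : normedModType R)
    (dot : H -> H -> R) (rho : R) (M : H -> H) : Prop :=
  forall x y : H, dot (M x - M y) (x - y) >= rho * `|x - y| ^+ 2.

Section Operators.
Variables (R : realType) (H : normedModType R).
Implicit Types M N : H -> H.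

(* (Id + M)^-1.  [pinv_] is total: it returns the default 0 off the range of
   Id + M, and some preimage where Id + M is not injective.  Neither occurs
   when H is a Hilbert space and M is a positive multiple of a cocoercive
   operator, since Id + M is then a bijection. *)
Definition resolvent M : H -> H :=
  'pinv_(fun=> 0) [set: H] (fun x => x + M x).

Definition explicit_op M : H -> H := fun x => x - M x.

Definition forward_backward N M : H -> H := resolvent N \o explicit_op M.

Definition reflected_resolvent M : H -> H := fun x => 2 *: resolvent M x - x.

Definition peaceman_rachford N M : H -> H :=
  reflected_resolvent N \o reflected_resolvent M.

Definition douglas_rachford N M : H -> H :=
  fun x => 2^-1 *: (x + peaceman_rachford N M x).

End Operators.

Section Rates.
Variables (R : realType) (alpha beta rho : R).
Implicit Type tau : R.

Definition omega_G tau : R :=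
  Num.sqrt (1 - 2 * tau * rho / (alpha * (2 * beta - tau))
                * (2 * beta * alpha - tau * (beta + alpha))).

Definition omega_T1 tau : R :=
  Num.sqrt (1 - tau * rho / alpha * (2 * alpha - tau)).

Definition omega_T2 tau : R := 1 / (1 + tau * rho).

Definition omega_R tau : R :=
  Num.sqrt ((alpha - 2 * tau * rho * alpha + tau ^+ 2 * rho)
            / (alpha + 2 * tau * rho * alpha + tau ^+ 2 * rho)).

Definition omega_S tau : R :=
  Num.min ((1 + omega_R tau) / 2)
          ((beta + tau ^+ 2 * rho) / (beta + tau * beta * rho + tau ^+ 2 * rho)).

End Rates.

Definition min_achieved_at (R : realType) (I : interval R) (f : R -> R)
    (t : R) : Prop :=
  t \in I /\ {in I, forall s, f t <= f s}.

(* Main.v *)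
(* With p = J_{tau M} x one has x = p + tau M p, so J, 2J - Id and
   Id - tau M act on differences by simple combinations of d = p - p' and
   e = M p - M p'; expanding the squared norms and using <e, d> >= eta |e|^2
   and <e, d> >= rho |d|^2 gives the rates of items 1-4.  Surjectivity of
   Id + tau M comes from Banach's fixed point theorem.  For the
   Douglas-Rachford operator, let u be the difference of two values of S; in
   either order x - y = u + tau (a + b), a and b being differences of
   values of the two operators, and monotonicity gives
   <u, a + b> >= rho |p|^2 + beta |b|^2, where p is the difference of the
   arguments of A and b that of the values of B; as p = u + tau b or
   p = u - tau b, this is at least (rho beta / (beta + tau^2 rho)) |u|^2. *)
Require Import Defs.
From HB Require Import structures.
From mathcomp Require Import all_boot all_order all_algebra.
From mathcomp Require Import all_classical all_reals all_analysis.
From mathcomp Require Import ring lra.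

Set Implicit Arguments.
Unset Strict Implicit.
Unset Printing Implicit Defensive.

Import Order.TTheory GRing.Theory Num.Theory.
Import numFieldNormedType.Exports.

Local Open Scope classical_set_scope.
Local Open Scope ring_scope.

(** * Pointwise form and composition of Lipschitz bounds *)

Lemma lipschitzTP (R : realType) (V W : normedModType R) (k : R) (f : V -> W) :
  k.-lipschitz f <-> forall x y, `|f x - f y| <= k * `|x - y|.
Proof.
split=> [fk x y|fk [x y] _]; last exact: fk.
exact: (fk (x, y)).
Qed.

Lemma lipschitz_comp (R : realType) (U V W : normedModType R) (k l m : R)
    (f : V -> W) (g : U -> V) : m = k * l -> 0 <= k ->
  k.-lipschitz f -> l.-lipschitz g -> m.-lipschitz (f \o g).
Proof.
move=> -> k0 /lipschitzTP fk /lipschitzTP gl; apply/lipschitzTP => x y /=.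
by rewrite (le_trans (fk _ _))// -mulrA ler_wpM2l.
Qed.

(** * Real analysis of the rates: their ranges and optimal steps *)

Section Rates.
Variable R : realType.
Implicit Types (alpha beta rho tau k s t : R).

Lemma sqrt_in01 k : 0 < k < 1 -> Num.sqrt k \in `]0, 1[.
Proof.
by move=> /andP[k0 k1]; rewrite in_itv/= sqrtr_gt0 k0 -[ltRHS]sqrtr1 ltr_sqrt.
Qed.

(** Keeps the denominator [alpha * (2 * beta - tau)] of [omega_G] positive on the admissible
    range. *)
Lemma omega_G_step_lt alpha beta tau : 0 < alpha -> 0 < beta ->
  tau < 2 * beta * alpha / (beta + alpha) -> tau < 2 * beta.
Proof.
move=> alpha0 beta0 /lt_trans; apply.
by rewrite ltr_pdivrMr ?addr_gt0// ltr_pM2l ?mulr_gt0// ltrDr.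
Qed.

Lemma omega_G_radicand_gt0 alpha beta rho tau :
    0 < alpha -> 0 < rho -> alpha * rho <= 1 -> 0 < tau -> tau < 2 * beta ->
  0 < 1 - 2 * tau * rho / (alpha * (2 * beta - tau))
          * (2 * beta * alpha - tau * (beta + alpha)).
Proof.
move=> alpha0 rho0 ar1 tau0; rewrite -subr_gt0 => w0.
(* The term [tau ^+ 3] keeps the radicand positive even when [alpha * rho = 1] and [tau = alpha],
   where the other terms vanish. *)
have -> : 1 - 2 * tau * rho / (alpha * (2 * beta - tau))
    * (2 * beta * alpha - tau * (beta + alpha)) = (1 - alpha * rho) +
    rho * ((2 * beta - tau) * (alpha - tau) ^+ 2 + tau ^+ 3)
        / (alpha * (2 * beta - tau)) by field; rewrite !gt_eqF.
rewrite ltr_wpDl ?subr_ge0// divr_gt0 ?mulr_gt0//.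
by rewrite ltr_wpDl ?exprn_gt0// mulr_ge0 ?sqr_ge0// ltW.
Qed.

(** Completing the square in [tau] yields at once the sign of the radicand, its minimiser [alpha]
    and its minimum. *)
Lemma omega_T1_radicandE alpha rho tau : 0 < alpha ->
  1 - tau * rho / alpha * (2 * alpha - tau)
  = (1 - alpha * rho) + rho / alpha * (tau - alpha) ^+ 2.
Proof. by move=> alpha0; field; rewrite gt_eqF. Qed.

Lemma omega_T1_radicand_ge0 alpha rho tau : 0 < alpha -> 0 <= rho ->
  alpha * rho <= 1 -> 0 <= 1 - tau * rho / alpha * (2 * alpha - tau).
Proof.
move=> alpha0 rho0 ar1; rewrite omega_T1_radicandE//.
by rewrite addr_ge0 ?subr_ge0// mulr_ge0 ?sqr_ge0// divr_ge0// ltW.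
Qed.

Lemma omega_R_num_ge0 alpha rho tau : 0 < alpha -> 0 <= rho ->
  alpha * rho <= 1 -> 0 <= alpha - 2 * tau * rho * alpha + tau ^+ 2 * rho.
Proof.
move=> alpha0 rho0 ar1.
have -> : alpha - 2 * tau * rho * alpha + tau ^+ 2 * rho
    = alpha * (1 - alpha * rho) + rho * (tau - alpha) ^+ 2 by ring.
by rewrite addr_ge0// mulr_ge0// ?sqr_ge0 ?subr_ge0// ltW.
Qed.

Lemma omega_R_den_gt0 alpha rho tau : 0 < alpha -> 0 <= rho -> 0 < tau ->
  0 < alpha + 2 * tau * rho * alpha + tau ^+ 2 * rho.
Proof.
move=> alpha0 rho0 tau0.
by rewrite -addrA ltr_wpDr// addr_ge0// !mulr_ge0// ?sqr_ge0// ltW.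
Qed.

Section RateBounds.
Variables (alpha beta rho : R).
Hypotheses (alpha_gt0 : 0 < alpha) (beta_gt0 : 0 < beta) (rho_gt0 : 0 < rho).
Hypothesis alpha_rho : alpha * rho <= 1.

(** When [rho = alpha^-1] and [tau = alpha], the radicands of [omega_T1] and [omega_R] vanish and
    both rates are 0. Outside this case, one of the two nonnegative summands left by completing the
    square in [tau] is positive. *)
Lemma nondegenerate tau : ~ (rho = alpha^-1 /\ tau = alpha) ->
  alpha * rho < 1 \/ tau != alpha.
Proof.
move=> ndeg; case: (eqVneq tau alpha) => [ta|]; last by right.
left; rewrite lt_neqAle alpha_rho andbT; apply/eqP => ar1; apply: ndeg.
by split=> //; apply: (mulfI (lt0r_neq0 alpha_gt0)); rewrite ar1 divff ?gt_eqF.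
Qed.

Lemma omega_G_in01 tau : 0 < tau < 2 * beta * alpha / (beta + alpha) ->
  omega_G alpha beta rho tau \in `]0, 1[.
Proof.
move=> /andP[tau0 tau1].
have tau2 := omega_G_step_lt alpha_gt0 beta_gt0 tau1.
move: tau1; rewrite ltr_pdivlMr ?addr_gt0// => tau1.
apply: sqrt_in01; rewrite omega_G_radicand_gt0//= gtrBl mulr_gt0 ?subr_gt0//.
by rewrite divr_gt0 ?mulr_gt0// subr_gt0.
Qed.

(* Radicands and rates exceed their minimum by a multiple of a square
   vanishing exactly at the optimal step. *)
Lemma omega_G_gap s t tau : 0 < t -> t < s -> t ^+ 2 = beta ->
    s ^+ 2 = beta + alpha -> tau < 2 * beta ->
  1 - 2 * tau * rho / (alpha * (2 * beta - tau))
      * (2 * beta * alpha - tau * (beta + alpha))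
  = 1 - 4 * rho * beta * alpha / (s + t) ^+ 2
    + 2 * rho * ((2 * beta - tau) * s - 2 * t ^+ 3) ^+ 2
      / (alpha * (2 * beta - tau)).
Proof.
move=> t0 ts t2 s2; rewrite -subr_gt0 => w0.
(* Expressing [alpha] and [beta] through [s] and [t] turns the claim into a rational identity. *)
have alphaE : alpha = s ^+ 2 - t ^+ 2 by lra.
move: w0 alpha_gt0; rewrite alphaE -t2 => w0 a0.
by field; rewrite !gt_eqF// addr_gt0// (lt_trans t0).
Qed.

Lemma omega_G_opt :
  let tau_opt := 2 * beta * alpha
      / (Num.sqrt (beta + alpha)
         * (Num.sqrt (beta + alpha) + Num.sqrt beta)) in
  min_achieved_at `]0, 2 * beta * alpha / (beta + alpha)[
    (omega_G alpha beta rho) tau_opt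
  /\ omega_G alpha beta rho tau_opt
     = Num.sqrt (1 - 4 * rho * beta * alpha
                     / (Num.sqrt (beta + alpha) + Num.sqrt beta) ^+ 2).
Proof.
have s2 : Num.sqrt (beta + alpha) ^+ 2 = beta + alpha.
  by rewrite sqr_sqrtr// addr_ge0// ltW.
have t2 : Num.sqrt beta ^+ 2 = beta by rewrite sqr_sqrtr// ltW.
have t0 : 0 < Num.sqrt beta by rewrite sqrtr_gt0.
have ts : Num.sqrt beta < Num.sqrt (beta + alpha).
  by rewrite ltr_sqrt ?addr_gt0// ltrDl.
move: s2 t2 t0 ts.
set s := Num.sqrt (beta + alpha); set t := Num.sqrt beta => s2 t2 t0 ts topt.
have s0 : 0 < s := lt_trans t0 ts.
have st0 : 0 < s + t by rewrite addr_gt0.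
have toptE : topt = 2 * beta * (s - t) / s.
  rewrite /topt; have -> : alpha = (s - t) * (s + t) by rewrite -subr_sqr; lra.
  by field; rewrite !gt_eqF.
have topt_lt : topt < 2 * beta.
  by rewrite toptE ltr_pdivrMr// ltr_pM2l ?mulr_gt0// gtrBl.
have optE : omega_G alpha beta rho topt
    = Num.sqrt (1 - 4 * rho * beta * alpha / (s + t) ^+ 2).
  rewrite /omega_G (omega_G_gap t0 ts)//.
  have -> : (2 * beta - topt) * s - 2 * t ^+ 3 = 0.
    by rewrite toptE -t2; field; rewrite gt_eqF.
  by rewrite expr0n mulr0 mul0r addr0.
split=> //; split.
  (* The optimal step is admissible because [s * (s + t)] exceeds [s ^+ 2], which is
     [beta + alpha]. *)
  rewrite in_itv/= divr_gt0 ?mulr_gt0//= /topt ltr_pM2l ?mulr_gt0//.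
  by rewrite ltf_pV2 ?posrE ?addr_gt0 ?mulr_gt0// -s2 expr2 ltr_pM2l// ltrDl.
move=> tau; rewrite in_itv/= => /andP[tau0 tau1].
have tau2 := omega_G_step_lt alpha_gt0 beta_gt0 tau1.
rewrite optE /omega_G ler_wsqrtr// (omega_G_gap t0 ts)// lerDl.
by rewrite !(divr_ge0, sqr_ge0, mulr_ge0, subr_ge0)//; exact: ltW.
Qed.

Lemma omega_T1_in01 tau : 0 < tau < 2 * alpha ->
  (omega_T1 alpha rho tau \in `[0, 1[) /\
  (~ (rho = alpha^-1 /\ tau = alpha) -> omega_T1 alpha rho tau \in `]0, 1[).
Proof.
move=> /andP[tau0 tau2].
have lt1 : 1 - tau * rho / alpha * (2 * alpha - tau) < 1.
  by rewrite gtrBl mulr_gt0 ?subr_gt0// divr_gt0 ?mulr_gt0.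
split.
  by rewrite in_itv/= sqrtr_ge0 -[ltRHS]sqrtr1 ltr_sqrt.
move=> /nondegenerate ndeg; apply: sqrt_in01; rewrite lt1 andbT.
rewrite omega_T1_radicandE//; case: ndeg => [ar1|ta].
  by rewrite ltr_wpDr ?subr_gt0// mulr_ge0 ?sqr_ge0// divr_ge0// ltW.
by rewrite ltr_wpDl ?subr_ge0// mulr_gt0 ?divr_gt0// exprn_even_gt0//= subr_eq0.
Qed.

Lemma omega_T1_opt :
  min_achieved_at `]0, 2 * alpha[ (omega_T1 alpha rho) alpha
  /\ omega_T1 alpha rho alpha = Num.sqrt (1 - alpha * rho).
Proof.
have optE : omega_T1 alpha rho alpha = Num.sqrt (1 - alpha * rho).
  by rewrite /omega_T1 omega_T1_radicandE// subrr expr0n mulr0 addr0.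
split=> //; split; first by rewrite in_itv/= alpha_gt0 ltr_pMl ?ltr1n.
move=> tau _; rewrite optE /omega_T1 omega_T1_radicandE// ler_wsqrtr// lerDl.
by rewrite !(sqr_ge0, divr_ge0, mulr_ge0)//; exact: ltW.
Qed.

Lemma omega_T2_in01 tau : 0 < tau -> omega_T2 rho tau \in `]0, 1[.
Proof.
move=> tau0; have tr0 := mulr_gt0 tau0 rho_gt0.
by rewrite in_itv/= divr_gt0 ?ltr_pdivrMr ?mul1r ?ltrDl ?addr_gt0.
Qed.

Lemma omega_T2_opt :
  min_achieved_at `]0, 2 * beta] (omega_T2 rho) (2 * beta)
  /\ omega_T2 rho (2 * beta) = 1 / (1 + 2 * beta * rho).
Proof.
split=> //; split; first by rewrite in_itv/= lexx mulr_gt0.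
move=> tau; rewrite in_itv/= => /andP[tau0 tau1].
rewrite /omega_T2 !div1r lef_pV2 ?posrE ?addr_gt0 ?mulr_gt0//.
by rewrite lerD2l ler_wpM2r// ltW.
Qed.

Lemma omega_R_in01 tau : 0 < tau ->
  (omega_R alpha rho tau \in `[0, 1[) /\
  (~ (rho = alpha^-1 /\ tau = alpha) -> omega_R alpha rho tau \in `]0, 1[).
Proof.
move=> tau0; have den0 := omega_R_den_gt0 alpha_gt0 (ltW rho_gt0) tau0.
have lt1 : (alpha - 2 * tau * rho * alpha + tau ^+ 2 * rho)
    / (alpha + 2 * tau * rho * alpha + tau ^+ 2 * rho) < 1.
  rewrite ltr_pdivrMr// mul1r.
  have : 0 < tau * rho * alpha by rewrite !mulr_gt0.
  by lra.
split.
  by rewrite in_itv/= sqrtr_ge0 -[ltRHS]sqrtr1 ltr_sqrt.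
move=> /nondegenerate ndeg; apply: sqrt_in01; rewrite lt1 andbT.
rewrite divr_gt0//.
have -> : alpha - 2 * tau * rho * alpha + tau ^+ 2 * rho
    = alpha * (1 - alpha * rho) + rho * (tau - alpha) ^+ 2 by ring.
case: ndeg => [ar1|ta].
  by rewrite ltr_wpDr ?mulr_gt0 ?subr_gt0// mulr_ge0 ?sqr_ge0// ltW.
rewrite ltr_wpDl ?mulr_ge0 ?subr_ge0 ?(ltW alpha_gt0)//.
by rewrite mulr_gt0// exprn_even_gt0//= subr_eq0.
Qed.

(** For [x] equal to [alpha] or [beta], [k] is the candidate optimal step. Substituting [x = s * k]
    and [rho = s / k] makes the rates rational in [k], [s] and [tau]. *)
Lemma sqrt_step x : 0 < x -> exists k s, [/\ k = Num.sqrt (x / rho),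
  s = Num.sqrt (x * rho), 0 < k, 0 < s & x = s * k /\ rho = s / k].
Proof.
move=> x0; exists (Num.sqrt (x / rho)), (Num.sqrt (x * rho)).
have k0 : 0 < x / rho by rewrite divr_gt0.
have s0 : 0 < x * rho by rewrite mulr_gt0.
split; rewrite ?sqrtr_gt0//; split.
  rewrite -sqrtrM ?(ltW s0)// (_ : x * rho * _ = x ^+ 2).
    by rewrite sqrtr_sqr gtr0_norm.
  by field; rewrite gt_eqF.
rewrite -sqrtrV ?(ltW k0)// -sqrtrM ?(ltW s0)// (_ : x * rho * _ = rho ^+ 2).
  by rewrite sqrtr_sqr gtr0_norm.
by field; rewrite !gt_eqF.
Qed.

Lemma omega_R_opt :
  let tau_opt := Num.sqrt (alpha / rho) in
  min_achieved_at `]0, +oo[ (omega_R alpha rho) tau_opt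
  /\ omega_R alpha rho tau_opt
     = Num.sqrt ((1 - Num.sqrt (alpha * rho)) / (1 + Num.sqrt (alpha * rho))).
Proof.
have [k [s [<- <- k0 s0 [alphaE rhoE]]]] := sqrt_step alpha_gt0.
(* In the new variables the radicand is [(k ^+ 2 + tau ^+ 2 - 2 * tau * k * s) / (k ^+ 2 + tau ^+ 2
   + 2 * tau * k * s)], smallest when [k ^+ 2 + tau ^+ 2 = 2 * tau * k]. *)
have gap tau : 0 < tau -> omega_R alpha rho tau = Num.sqrt ((1 - s) / (1 + s)
    + 2 * s * (tau - k) ^+ 2
      / ((1 + s) * (k ^+ 2 + tau ^+ 2 + 2 * tau * k * s))).
  move=> tau0; rewrite /omega_R alphaE rhoE; congr (Num.sqrt _).
  have den0 : 0 < k ^+ 2 + tau ^+ 2 + 2 * tau * k * s.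
    by rewrite !addr_gt0 ?mulr_gt0.
  by field; rewrite !gt_eqF// !(exprn_gt0, addr_gt0, mulr_gt0).
have optE : omega_R alpha rho k = Num.sqrt ((1 - s) / (1 + s)).
  by rewrite gap// subrr expr0n mulr0 mul0r addr0.
split=> //; split; first by rewrite in_itv/= k0.
move=> tau; rewrite in_itv/= andbT => tau0.
rewrite optE gap// ler_wsqrtr// lerDl.
by rewrite !(divr_ge0, sqr_ge0, addr_ge0, mulr_ge0)//; exact: ltW.
Qed.

Lemma douglas_rachford_rate_opt :
  let rate tau := (beta + tau ^+ 2 * rho)
                  / (beta + tau * beta * rho + tau ^+ 2 * rho) in
  let tau_opt := Num.sqrt (beta / rho) in
  min_achieved_at `]0, +oo[ rate tau_opt
  /\ rate tau_opt = 2 / (2 + Num.sqrt (beta * rho)).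
Proof.
move=> rate; have [k [s [<- <- k0 s0 [betaE rhoE]]]] := sqrt_step beta_gt0.
have gap tau : 0 < tau -> rate tau = 2 / (2 + s)
    + s * (tau - k) ^+ 2 / ((2 + s) * (k ^+ 2 + tau ^+ 2 + tau * k * s)).
  move=> tau0; rewrite /rate betaE rhoE.
  have den0 : 0 < k ^+ 2 + tau ^+ 2 + tau * k * s.
    by rewrite !addr_gt0 ?mulr_gt0.
  by field; rewrite !gt_eqF// !(exprn_gt0, addr_gt0, mulr_gt0).
have optE : rate k = 2 / (2 + s).
  by rewrite gap// subrr expr0n mulr0 mul0r addr0.
split=> //; split; first by rewrite in_itv/= k0.
move=> tau; rewrite in_itv/= andbT => tau0.
rewrite optE gap// lerDl.
by rewrite !(divr_ge0, sqr_ge0, addr_ge0, mulr_ge0)//; exact: ltW.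
Qed.

(** Averaging with 1 keeps the first branch at least 1/2 even where [omega_R] vanishes, so no
    degenerate case has to be excluded. *)
Lemma omega_S_in01 tau : 0 < tau -> omega_S alpha beta rho tau \in `]0, 1[.
Proof.
move=> tau0; have [wR _] := omega_R_in01 tau0.
have rate0 : 0 < beta + tau ^+ 2 * rho by rewrite addr_gt0 ?mulr_gt0.
have tbr0 : 0 < tau * beta * rho by rewrite !mulr_gt0.
move: wR; rewrite !in_itv/= /omega_S lt_min gt_min => /andP[w0 w1].
apply/andP; split; last by apply/orP; left; lra.
by apply/andP; split; [lra | rewrite divr_gt0//; lra].
Qed.

(** A pointwise minimum is minimised by whichever branch has the smaller minimum. *)
Lemma min_achieved_at_min (I : interval R) (f g : R -> R) t1 t2 :
    min_achieved_at I f t1 -> min_achieved_at I g t2 -> f t1 <= g t2 ->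
  min_achieved_at I (fun x => Num.min (f x) (g x)) t1
  /\ Num.min (f t1) (g t1) = f t1.
Proof.
move=> [t1I fmin] [t2I gmin] fg.
have optE : Num.min (f t1) (g t1) = f t1.
  by apply/min_idPl; rewrite (le_trans fg)// gmin.
split=> //; split=> // x xI.
by rewrite optE le_min fmin//= (le_trans fg)// gmin.
Qed.

Lemma omega_S_opt :
  let small_beta :=
    beta <= 4 * alpha / (1 + Num.sqrt (1 - alpha * rho)) ^+ 2 in
  let tau_opt := if small_beta then Num.sqrt (alpha / rho)
                 else Num.sqrt (beta / rho) in
  min_achieved_at `]0, +oo[ (omega_S alpha beta rho) tau_opt
  /\ omega_S alpha beta rho tau_opt
     = if small_beta
       then (1 + Num.sqrt (1 - alpha * rho))
            / (1 + Num.sqrt (1 - alpha * rho) + Num.sqrt (alpha * rho))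
       else 2 / (2 + Num.sqrt (beta * rho)).
Proof.
have [fmin fE] := omega_R_opt; have [gmin gE] := douglas_rachford_rate_opt.
set f := fun tau => (1 + omega_R alpha rho tau) / 2.
have {}fmin : min_achieved_at `]0, +oo[ f (Num.sqrt (alpha / rho)).
  by case: fmin => tI fmin; split=> // x /fmin wx; rewrite /f; lra.
have c2 : Num.sqrt (1 - alpha * rho) ^+ 2 = 1 - alpha * rho.
  by rewrite sqr_sqrtr// subr_ge0.
have s2 : Num.sqrt (alpha * rho) ^+ 2 = alpha * rho.
  by rewrite sqr_sqrtr// mulr_ge0// ltW.
have v2 : Num.sqrt (beta * rho) ^+ 2 = beta * rho.
  by rewrite sqr_sqrtr// mulr_ge0// ltW.
have s0 : 0 < Num.sqrt (alpha * rho) by rewrite sqrtr_gt0 mulr_gt0.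
have v0 : 0 < Num.sqrt (beta * rho) by rewrite sqrtr_gt0 mulr_gt0.
have c0 := sqrtr_ge0 (1 - alpha * rho).
move: c2 s2 v2 s0 v0 c0 fE gE; set c := Num.sqrt (1 - _).
set s := Num.sqrt (alpha * rho); set v := Num.sqrt (beta * rho).
move=> c2 s2 v2 s0 v0 c0 fE gE.
have {}fE : f (Num.sqrt (alpha / rho)) = (1 + c) / (1 + c + s).
  (* Since [c ^+ 2 = 1 - s ^+ 2 = (1 - s) * (1 + s)], the radicand is a perfect square. *)
  rewrite /f fE (_ : (1 - s) / (1 + s) = (c / (1 + s)) ^+ 2).
    rewrite sqrtr_sqr ger0_norm ?divr_ge0//; last by lra.
    have -> : 1 + c / (1 + s) = (1 + s + c) / (1 + s) by field; lra.
    rewrite -mulrA -invfM; apply/eqP; rewrite eqr_div; [|lra..].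
    by apply/eqP; lra.
  rewrite expr_div_n c2 -s2; by field; lra.
(* The threshold on [beta] is exactly the comparison of the two branch minima: both sides reduce to
   [v * (1 + c) <= 2 * s]. *)
have cmp : (beta <= 4 * alpha / (1 + c) ^+ 2)
    = ((1 + c) / (1 + c + s) <= 2 / (2 + v)).
  have c10 : 0 < (1 + c) ^+ 2 by rewrite exprn_gt0//; lra.
  rewrite ler_pdivlMr// -(ler_pM2r rho_gt0).
  have -> : beta * (1 + c) ^+ 2 * rho = (v * (1 + c)) ^+ 2.
    by rewrite exprMn v2; ring.
  have -> : 4 * alpha * rho = (2 * s) ^+ 2 by rewrite exprMn s2; ring.
  rewrite ler_pXn2r ?nnegrE ?(mulr_ge0, addr_ge0, ltW s0, ltW v0)//.
  rewrite ler_pdivrMr; last by lra.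
  rewrite mulrAC ler_pdivlMr; last by lra.
  by apply/idP/idP; lra.
rewrite /= cmp; case: leP => [fg|/ltW gf].
  by rewrite -fE; apply: (min_achieved_at_min fmin gmin); rewrite fE gE.
move: gf; rewrite -fE -gE => gf.
have [[tI mint] E] := min_achieved_at_min gmin fmin gf.
split; last by rewrite /omega_S minC; exact: E.
split=> // x xI; rewrite /omega_S ![Num.min ((1 + _) / _) _]minC.
exact: mint.
Qed.
End RateBounds.
End Rates.

(** * Inner product calculus and Lipschitz bounds from squared norms *)

Section Hilbert.
Variables (R : realType) (H : completeNormedModType R).
Variables (dot : {dot H for idfun}).
Hypothesis dot_norm : forall x : H, dot x x = `|x| ^+ 2.
Implicit Types (x y u v : H) (M N : H -> H) (k eta rho tau : R).

Lemma dotC x y : dot x y = dot y x.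
Proof. by rewrite hermC expr0 mul1r. Qed.

Lemma dot_ge0 x : 0 <= dot x x.
Proof. by rewrite dot_norm sqr_ge0. Qed.

Lemma dotDl x y u : dot (x + y) u = dot x u + dot y u.
Proof. exact: linearDl. Qed.

Lemma dotDr x y u : dot u (x + y) = dot u x + dot u y.
Proof. exact: linearDr. Qed.

Lemma dotBr x y u : dot u (x - y) = dot u x - dot u y.
Proof. exact: linearBr. Qed.

Lemma dotZl k x y : dot (k *: x) y = k * dot x y.
Proof. exact: linearZl_LR. Qed.

Lemma dotZr k x y : dot x (k *: y) = k * dot x y.
Proof. exact: linearZr_LR. Qed.

Lemma dotDD k x y :
  dot (x + k *: y) (x + k *: y) = dot x x + 2 * k * dot x y + k ^+ 2 * dot y y.
Proof. by rewrite dotDl !dotDr !dotZl !dotZr (dotC y x); ring. Qed.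

Lemma dotBB k x y :
  dot (x - k *: y) (x - k *: y) = dot x x - 2 * k * dot x y + k ^+ 2 * dot y y.
Proof. by rewrite -scaleNr dotDD; ring. Qed.

(** Expanding the nonnegative square of [v - rho *: u] bounds [dot v v] from below, which replaces
    Cauchy-Schwarz. Serves both the resolvent and the Douglas-Rachford operator. *)
Lemma strong_dot_bound rho tau u v : 0 <= rho -> 0 < tau ->
  rho * dot u u <= dot u v ->
  dot u u <= (1 / (1 + tau * rho)) ^+ 2 * dot (u + tau *: v) (u + tau *: v).
Proof.
move=> rho0 tau0 uv; have tr0 : 0 <= tau * rho by rewrite mulr_ge0// ltW.
rewrite expr_div_n expr1n mulrAC ler_pdivlMr ?exprn_gt0//; last by lra.
rewrite mul1r dotDD; have := dot_ge0 (v - rho *: u); rewrite dotBB (dotC v).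
have := ler_wpM2l (ltW tau0) uv.
have := ler_wpM2l (mulr_ge0 (ltW tau0) tr0) uv.
move=> h1 h2 /(ler_wpM2l (sqr_ge0 tau)).
lra.
Qed.

Lemma lipschitz_sq k M : 0 <= k ->
  (forall x y, dot (M x - M y) (M x - M y) <= k ^+ 2 * dot (x - y) (x - y)) ->
  k.-lipschitz M.
Proof.
move=> k0 Mk; apply/lipschitzTP => x y.
rewrite -(@ler_pXn2r _ 2) ?nnegrE ?mulr_ge0// exprMn -!dot_norm; exact: Mk.
Qed.

Lemma lipschitz_sqrt k M : 0 <= k ->
  (forall x y, dot (M x - M y) (M x - M y) <= k * dot (x - y) (x - y)) ->
  (Num.sqrt k).-lipschitz M.
Proof. by move=> k0 Mk; apply: lipschitz_sq => // x y; rewrite sqr_sqrtr. Qed.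

Lemma cocoercive_monotone eta M : 0 <= eta ->
  cocoercive dot eta M -> strongly_monotone dot 0 M.
Proof.
move=> eta0 Meta x y; rewrite mul0r (le_trans _ (Meta _ _))//.
by rewrite mulr_ge0// sqr_ge0.
Qed.

(** * Explicit operators, resolvents and reflected resolvents *)

Lemma explicit_opB tau M x y :
  explicit_op (tau *: M) x - explicit_op (tau *: M) y
  = (x - y) - tau *: (M x - M y).
Proof. by rewrite /explicit_op /= opprD addrACA -opprD -scalerBr. Qed.

Lemma add_scale_surj eta tau M y : 0 < eta -> 0 < tau ->
  cocoercive dot eta M -> exists x, x + tau *: M x = y.
Proof.
move=> eta0 tau0 Meta.
have den0 : 0 < 2 * eta + tau by lra.
(* the largest step for which the map [f] below is (1 - g)-Lipschitz *)
have [g [g0 g1 gE]] : exists g, [/\ 0 < g, 0 < 1 - g &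
    (1 - g) * (2 * eta) = g * tau].
  exists (2 * eta / (2 * eta + tau)).
  have -> : 1 - 2 * eta / (2 * eta + tau) = tau / (2 * eta + tau).
    by field; lra.
  by split; [apply: divr_gt0; lra | apply: divr_gt0 | field; lra].
(* [f x] is [x - g *: (x + tau *: M x - y)], so its fixed points are the solutions. *)
pose f x := (1 - g) *: x - (g * tau) *: M x + g *: y.
have fcontr : is_contraction (totalfun f).
  have g1' : 0 <= 1 - g by lra.
  exists (NngNum g1'); split=> /=; first by lra.
  apply: lipschitz_sq => // u v.
  have -> : totalfun f u - totalfun f v
      = (1 - g) *: (u - v) - (g * tau) *: (M u - M v).
    rewrite /totalfun /= /f opprD addrACA subrr addr0 opprD addrACA -opprD.
    by rewrite -!scalerBr.
  rewrite dotBB !dotZl dotZr (dotC (u - v) (M u - M v)).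
  have := Meta u v; rewrite -dot_norm.
  set P := dot (u - v) _; set Q := dot _ (u - v); set S := dot _ _ => QS.
  have S0 : 0 <= S by exact: dot_ge0.
  (* By the choice of [g], cocoercivity makes the cross term absorb the [S] term, leaving only
     [(1 - g) ^+ 2] times the squared distance. *)
  have -> : (g * tau) ^+ 2 * S = 2 * (g * tau * (1 - g)) * (eta * S).
    by rewrite -gE; ring.
  have c0 : 0 <= 2 * (g * tau * (1 - g)) by rewrite !mulr_ge0//; lra.
  have := ler_wpM2l c0 QS.
  lra.
have [||p _ pE] := banach_fixed_point fcontr.
- exact: closedT.
- by exists 0.
exists p; apply: (@scalerI _ _ g); first by rewrite gt_eqF.
rewrite scalerDr scalerA.
have : p = (1 - g) *: p - (g * tau) *: M p + g *: y by exact: pE.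
rewrite scalerBl scale1r -!addrA => /esym/(canRL (addKr p)).
by rewrite addNr addrA -opprD addrC => /subr0_eq ->.
Qed.

(** By surjectivity [pinv_] never returns its default 0: it sends every point to one of its
    preimages. *)
Lemma resolventK eta tau M x : 0 < eta -> 0 < tau -> cocoercive dot eta M ->
  resolvent (tau *: M) x + tau *: M (resolvent (tau *: M) x) = x.
Proof.
move=> eta0 tau0 Meta; have [p px] := add_scale_surj x eta0 tau0 Meta.
apply: (pinvK (fun=> 0) (A := setT) (f := fun x => x + (tau *: M) x)).
by apply/mem_set; exists p.
Qed.

Section Resolvent.
Variables (eta rho tau : R) (M : H -> H).
Hypotheses (eta_gt0 : 0 < eta) (rho_ge0 : 0 <= rho) (tau_gt0 : 0 < tau).
Hypothesis M_coco : cocoercive dot eta M.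
Hypothesis M_smono : strongly_monotone dot rho M.

Let J := resolvent (tau *: M).

Lemma resolvent_decomp x y :
  x - y = (J x - J y) + tau *: (M (J x) - M (J y)).
Proof.
rewrite -[in LHS](resolventK x eta_gt0 tau_gt0 M_coco).
rewrite -[in LHS](resolventK y eta_gt0 tau_gt0 M_coco).
by rewrite opprD addrACA scalerBr.
Qed.

Lemma reflected_resolventE x :
  reflected_resolvent (tau *: M) x = J x - tau *: M (J x).
Proof.
rewrite /reflected_resolvent -{2}[x](resolventK x eta_gt0 tau_gt0 M_coco) -/J.
by rewrite scaler_nat mulr2n opprD addrA addrK.
Qed.

Lemma reflected_resolventB x y :
  reflected_resolvent (tau *: M) x - reflected_resolvent (tau *: M) y
  = (J x - J y) - tau *: (M (J x) - M (J y)).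
Proof. by rewrite !reflected_resolventE opprD addrACA -opprD -scalerBr. Qed.

Lemma resolvent_lipschitz : (1 / (1 + tau * rho)).-lipschitz J.
Proof.
have tr0 : 0 <= tau * rho by rewrite mulr_ge0// ltW.
apply: lipschitz_sq => [|x y]; first by rewrite divr_ge0//; lra.
rewrite (resolvent_decomp x y); apply: strong_dot_bound => //.
by rewrite dotC dot_norm; exact: M_smono.
Qed.

Lemma reflected_resolvent_lipschitz : eta * rho <= 1 ->
  (omega_R eta rho tau).-lipschitz (reflected_resolvent (tau *: M)).
Proof.
move=> er1.
have den0 := omega_R_den_gt0 eta_gt0 rho_ge0 tau_gt0.
apply: lipschitz_sqrt => [|x y].
  by rewrite divr_ge0 ?omega_R_num_ge0// ltW.
rewrite reflected_resolventB (resolvent_decomp x y) dotDD dotBB.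
have := M_smono (J x) (J y); have := M_coco (J x) (J y).
rewrite -!dot_norm (dotC (M (J x) - M (J y)) (J x - J y)).
set P := dot _ _; set Q := dot _ _; set S := dot _ _ => QS QP.
rewrite [leRHS]mulrAC ler_pdivlMr//.
(* With the denominator cleared, the gap between the two sides is [c1] times the slack of strong
   monotonicity plus [c2] times that of cocoercivity. *)
have c1 : 0 <= 4 * tau * eta by rewrite !mulr_ge0// ltW.
have c2 : 0 <= 4 * tau * (tau ^+ 2 * rho) by rewrite !mulr_ge0// ltW.
have := ler_wpM2l c1 QP; have := ler_wpM2l c2 QS.
lra.
Qed.

Lemma explicit_lipschitz : eta * rho <= 1 -> tau <= 2 * eta ->
  (omega_T1 eta rho tau).-lipschitz (explicit_op (tau *: M)).
Proof.
move=> er1 taueta.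
apply: lipschitz_sqrt => [|x y]; first exact: omega_T1_radicand_ge0.
rewrite explicit_opB dotBB.
have := M_smono x y; have := M_coco x y.
rewrite -!dot_norm (dotC (M x - M y) (x - y)).
set P := dot (x - y) (x - y); set Q := dot (x - y) _.
set S := dot _ _ => QS QP.
(* The cross term [2 * tau * Q] is split in two: the share [c2] cancels [tau ^+ 2 * S] by
   cocoercivity, and the share [c1], nonnegative because [tau <= 2 * eta], goes to strong
   monotonicity. *)
have c1 : 0 <= tau / eta * (2 * eta - tau).
  by rewrite mulr_ge0 ?subr_ge0// divr_ge0// ltW.
have c2 : 0 <= tau ^+ 2 / eta by rewrite divr_ge0 ?sqr_ge0// ltW.
have := ler_wpM2l c1 QP; have := ler_wpM2l c2 QS.
have -> : tau ^+ 2 / eta * (eta * S) = tau ^+ 2 * S by field; rewrite gt_eqF.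
have -> : 2 * tau * Q = tau / eta * (2 * eta - tau) * Q + tau ^+ 2 / eta * Q.
  by field; rewrite gt_eqF.
lra.
Qed.
End Resolvent.

Lemma explicit_sum_lipschitz alpha beta rho tau M N :
    0 < alpha -> 0 < beta -> 0 < rho -> alpha * rho <= 1 ->
    0 < tau < 2 * beta * alpha / (beta + alpha) ->
    cocoercive dot alpha M -> strongly_monotone dot rho M ->
    cocoercive dot beta N ->
  (omega_G alpha beta rho tau).-lipschitz (explicit_op (tau *: (M + N))).
Proof.
move=> alpha0 beta0 rho0 ar1 /andP[tau0 tau1] M_coco M_smono N_coco.
have tau2 : 0 < 2 * beta - tau by rewrite subr_gt0; exact: omega_G_step_lt tau1.
move: tau1; rewrite ltr_pdivlMr ?addr_gt0// => tau1.
apply: lipschitz_sqrt => [|x y].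
  by rewrite ltW// omega_G_radicand_gt0// -subr_gt0.
rewrite explicit_opB.
(* complete the square in N x - N y, whose quadratic part is
   tau * (2 * beta - tau), then use cocoercivity of M *)
have -> : (M + N) x - (M + N) y = (M x - M y) + 1 *: (N x - N y).
  by rewrite scale1r /= opprD addrACA.
have := N_coco x y; have := M_smono x y; have := M_coco x y.
rewrite -!dot_norm (dotC (M x - M y) (x - y)) (dotC (N x - N y) (x - y)).
have := dot_ge0 (tau *: (M x - M y) - (2 * beta - tau) *: (N x - N y)).
rewrite !dotBB dotDD [dot (x - y) (_ + 1 *: _)]dotDr !dotZr !dotZl.
set Sa := dot (M x - M y) (M x - M y); set Sb := dot (N x - N y) (N x - N y).
set P := dot (x - y) (x - y); set Qa := dot (x - y) (M x - M y).
set Qb := dot (x - y) (N x - N y); set X := dot (M x - M y) (N x - N y).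
move=> sq QSa QPa QSb.
have -> : 2 * tau * rho / (alpha * (2 * beta - tau))
    * (2 * beta * alpha - tau * (beta + alpha))
  = rho * (2 * (tau / (2 * beta - tau) / alpha)
    * (2 * beta * alpha - tau * (beta + alpha))) by field; lra.
have [k k0 kE] : exists2 k, 0 <= k & k = tau / (2 * beta - tau) / alpha.
  by exists (tau / (2 * beta - tau) / alpha) => //; rewrite !divr_ge0// ltW.
rewrite -kE.
(* [c2] is the part of [Qa] spent on cocoercivity of [M]; [c1] is what remains for strong
   monotonicity, nonnegative by the upper bound on [tau]. *)
have c1 : 0 <= 2 * k * (2 * beta * alpha - tau * (beta + alpha)).
  by rewrite !mulr_ge0//; lra.
have c2 : 0 <= 2 * beta * tau * k by rewrite !mulr_ge0// ltW.
have h1 := ler_wpM2l c1 QPa.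
have h2 := ler_wpM2l c2 QSa.
have h3 := mulr_ge0 (mulr_ge0 k0 (ltW alpha0)) sq.
have h4 := ler_wpM2l (ltW tau0) QSb.
(* Clears [k] from the products so that only linear arithmetic remains. *)
have E z : k * alpha * (2 * beta - tau) * z = tau * z by rewrite kE; field; lra.
have := E (tau * X); have := E ((2 * beta - tau) * Sb).
have := E (tau * Sa); have := E Qa.
lra.
Qed.

(** * The Douglas-Rachford operator *)

(** Meant for [p], [tau *: a], [q], [tau *: b] in place of [x], [y], [u], [v]: the conclusions then
    give the difference of two Douglas-Rachford values and relate it to that of their arguments. *)
Lemma group_decomp x y u v : x - y = u + v ->
  2^-1 *: ((x + y) + (u - v)) = u + y /\ x + y = (u + y) + (y + v).
Proof.
move=> /(canRL (subrK y)) ->; split.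
  have -> : u + v + y + y + (u - v) = 2 *: (u + y).
    rewrite scaler_nat mulr2n [LHS](AC (4*2) ((1*3)*(5*4)*(2*6))).
    by rewrite /= subrr addr0.
  by rewrite scalerA mulVf// scale1r.
by rewrite [LHS](AC 4 (1*3*(4*2))).
Qed.

Lemma douglas_rachford_decomp eta kappa tau M N x y :
    0 < eta -> 0 < kappa -> 0 < tau ->
    cocoercive dot eta M -> cocoercive dot kappa N ->
  let J := resolvent (tau *: M) in
  let K := resolvent (tau *: N) \o reflected_resolvent (tau *: M) in
  let p := J x - J y in let a := M (J x) - M (J y) in
  let q := K x - K y in let b := N (K x) - N (K y) in
  let u := douglas_rachford (tau *: N) (tau *: M) x
           - douglas_rachford (tau *: N) (tau *: M) y in
  [/\ p = u + tau *: b, q = u - tau *: a & x - y = u + tau *: (a + b)].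
Proof.
move=> eta0 kappa0 tau0 M_coco N_coco J K p a q b u.
have xy : x - y = p + tau *: a := resolvent_decomp eta0 tau0 M_coco x y.
(* The output of the first reflection is the input of the second resolvent, so its difference splits
   in two ways. *)
have z : p - tau *: a = q + tau *: b.
  rewrite -(reflected_resolventB eta0)//.
  exact: resolvent_decomp kappa0 tau0 N_coco _ _.
have [u1 xy1] := group_decomp z.
have uE : u = q + tau *: a.
  rewrite -u1 -xy /u /douglas_rachford -scalerBr opprD addrACA.
  by rewrite /peaceman_rachford/= (reflected_resolventB kappa0).
split.
- by rewrite uE -addrAC -z subrK.
- by rewrite uE addrK.
- by rewrite scalerDr uE xy.
Qed.

(** [k] is [tau] or [- tau] according to the order of composition; only its square affects the
    bound. *)
Lemma douglas_rachford_bound rho beta tau u v b p k :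
    0 < beta -> 0 < rho -> 0 < tau -> k ^+ 2 = tau ^+ 2 -> p = u + k *: b ->
    rho * dot p p + beta * dot b b <= dot u v ->
  dot u u <= ((beta + tau ^+ 2 * rho)
              / (beta + tau * beta * rho + tau ^+ 2 * rho)) ^+ 2
             * dot (u + tau *: v) (u + tau *: v).
Proof.
move=> beta0 rho0 tau0 k2 -> puv.
have d0 : 0 < beta + tau ^+ 2 * rho by rewrite addr_gt0// mulr_gt0// exprn_gt0.
have d1 : 0 < tau * beta * rho by rewrite !mulr_gt0.
have -> : (beta + tau ^+ 2 * rho) / (beta + tau * beta * rho + tau ^+ 2 * rho)
    = 1 / (1 + tau * (rho * beta / (beta + tau ^+ 2 * rho))).
  by field; lra.
apply: strong_dot_bound => //.
  by rewrite divr_ge0 ?mulr_ge0// ltW.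
apply: le_trans puv; rewrite mulrAC ler_pdivrMr//.
(* For fixed [u], the left side of the hypothesis is a quadratic in [b], minimal where this vector
   vanishes; its square is the excess over the minimum, up to the factor [beta + tau ^+ 2 * rho]. *)
have := dot_ge0 ((rho * k) *: u + (beta + tau ^+ 2 * rho) *: b).
rewrite !dotDD !dotZl !dotZr k2; set U := dot u u; set X := dot u b.
set S := dot b b => sq.
rewrite -subr_ge0; apply: le_trans sq _; rewrite le_eqVlt -k2; apply/orP; left.
by apply/eqP; ring.
Qed.

Section DouglasRachford.
Variables (alpha beta rho tau : R) (M N : H -> H).
Hypotheses (alpha_gt0 : 0 < alpha) (beta_gt0 : 0 < beta).
Hypotheses (rho_gt0 : 0 < rho) (tau_gt0 : 0 < tau).
Hypothesis M_coco : cocoercive dot alpha M.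
Hypothesis M_smono : strongly_monotone dot rho M.
Hypothesis (N_coco : cocoercive dot beta N).

Let kappa := (beta + tau ^+ 2 * rho)
             / (beta + tau * beta * rho + tau ^+ 2 * rho).

Let kappa_ge0 : 0 <= kappa.
Proof. by rewrite divr_ge0// !addr_ge0// ?mulr_ge0// ?sqr_ge0// ltW. Qed.

Lemma douglas_rachford_lipschitzl :
  kappa.-lipschitz (douglas_rachford (tau *: N) (tau *: M)).
Proof.
apply: lipschitz_sq => // x y.
have [] := douglas_rachford_decomp x y alpha_gt0 beta_gt0 tau_gt0 M_coco N_coco.
set p := (X in X = _ -> _); set q := (X in _ -> X = _ -> _).
set u := douglas_rachford _ _ _ - _; set a := M _ - _; set b := N _ - _.
move=> pE qE ->.
apply: (douglas_rachford_bound (k := tau) (p := p) (b := b)) => //.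
have := lerD (M_smono _ _ : rho * `|p| ^+ 2 <= dot a p)
             (N_coco _ _ : beta * `|b| ^+ 2 <= dot b q).
rewrite -!dot_norm => h; apply: le_trans h _.
(* Substituting [p = u + tau *: b] and [q = u - tau *: a] makes the two cross terms in [dot a b]
   cancel. *)
rewrite pE qE [dot a _]dotDr [dot b _]dotBr [dot u _]dotDr !dotZr.
by rewrite (dotC b a) (dotC b u) (dotC a u); lra.
Qed.

Lemma douglas_rachford_lipschitzr :
  kappa.-lipschitz (douglas_rachford (tau *: M) (tau *: N)).
Proof.
apply: lipschitz_sq => // x y.
have [] := douglas_rachford_decomp x y beta_gt0 alpha_gt0 tau_gt0 N_coco M_coco.
set p := (X in X = _ -> _); set q := (X in _ -> X = _ -> _).
set u := douglas_rachford _ _ _ - _; set a := N _ - _; set b := M _ - _.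
move=> pE qE ->.
(* The strongly monotone operator is now applied second: its arguments differ by [q = u - tau *: a],
   hence the sign. *)
apply: (douglas_rachford_bound (k := - tau) (p := q) (b := a)) => //.
- by rewrite sqrrN.
- by rewrite scaleNr.
have := lerD (M_smono _ _ : rho * `|q| ^+ 2 <= dot b q)
             (N_coco _ _ : beta * `|a| ^+ 2 <= dot a p).
rewrite -!dot_norm => h; apply: le_trans h _.
rewrite pE qE [dot a _]dotDr [dot b _]dotBr [dot u _]dotDr !dotZr.
by rewrite (dotC b a) (dotC b u) (dotC a u); lra.
Qed.
End DouglasRachford.
End Hilbert.

(** * The five items, obtained by composing the estimates for [A] and [B] *)

Theorem proposition3 (R : realType)
    (H : completeNormedModType R) (dot : {dot H for idfun})
    (dot_norm : forall x : H, dot x x = `|x| ^+ 2)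
    (alpha beta rho : R) (alpha_gt0 : 0 < alpha) (beta_gt0 : 0 < beta)
    (rho_itv : rho \in `]0, alpha^-1])
    (A B : H -> H)
    (A_coco : cocoercive dot alpha A) (A_smono : strongly_monotone dot rho A)
    (B_coco : cocoercive dot beta B)
    (zero_AB : exists x : H, A x + B x = 0)
    (tau : R) (tau_gt0 : 0 < tau) :
  [/\
    (* 1 *)
    (tau \in `]0, 2 * beta * alpha / (beta + alpha)[ ->
       (omega_G alpha beta rho tau).-lipschitz (explicit_op (tau *: (A + B)))
       /\ omega_G alpha beta rho tau \in `]0, 1[)
    /\ (let tau_opt := 2 * beta * alpha
            / (Num.sqrt (beta + alpha)
               * (Num.sqrt (beta + alpha) + Num.sqrt beta)) in
        min_achieved_at `]0, 2 * beta * alpha / (beta + alpha)[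
          (omega_G alpha beta rho) tau_opt
        /\ omega_G alpha beta rho tau_opt
           = Num.sqrt (1 - 4 * rho * beta * alpha
                           / (Num.sqrt (beta + alpha) + Num.sqrt beta) ^+ 2)),
    (* 2 *)
    (tau \in `]0, 2 * alpha[ ->
       [/\ (omega_T1 alpha rho tau).-lipschitz
             (forward_backward (tau *: B) (tau *: A)),
           omega_T1 alpha rho tau \in `[0, 1[
         & ~ (rho = alpha^-1 /\ tau = alpha) ->
           omega_T1 alpha rho tau \in `]0, 1[])
    /\ (min_achieved_at `]0, 2 * alpha[ (omega_T1 alpha rho) alpha
        /\ omega_T1 alpha rho alpha = Num.sqrt (1 - alpha * rho)),
    (* 3 *)
    (tau \in `]0, 2 * beta] ->
       (omega_T2 rho tau).-lipschitz (forward_backward (tau *: A) (tau *: B))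
       /\ omega_T2 rho tau \in `]0, 1[)
    /\ (min_achieved_at `]0, 2 * beta] (omega_T2 rho) (2 * beta)
        /\ omega_T2 rho (2 * beta) = 1 / (1 + 2 * beta * rho)),
    (* 4 *)
    [/\ (omega_R alpha rho tau).-lipschitz
          (peaceman_rachford (tau *: B) (tau *: A)),
        (omega_R alpha rho tau).-lipschitz
          (peaceman_rachford (tau *: A) (tau *: B)),
        omega_R alpha rho tau \in `[0, 1[
      & ~ (rho = alpha^-1 /\ tau = alpha) ->
        omega_R alpha rho tau \in `]0, 1[]
    /\ (let tau_opt := Num.sqrt (alpha / rho) in
        min_achieved_at `]0, +oo[ (omega_R alpha rho) tau_opt
        /\ omega_R alpha rho tau_opt
           = Num.sqrt ((1 - Num.sqrt (alpha * rho))
                       / (1 + Num.sqrt (alpha * rho))))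
  & (* 5 *)
    [/\ (omega_S alpha beta rho tau).-lipschitz
          (douglas_rachford (tau *: B) (tau *: A)),
        (omega_S alpha beta rho tau).-lipschitz
          (douglas_rachford (tau *: A) (tau *: B))
      & omega_S alpha beta rho tau \in `]0, 1[]
    /\ (let small_beta :=
          beta <= 4 * alpha / (1 + Num.sqrt (1 - alpha * rho)) ^+ 2 in
        let tau_opt := if small_beta then Num.sqrt (alpha / rho)
                       else Num.sqrt (beta / rho) in
        min_achieved_at `]0, +oo[ (omega_S alpha beta rho) tau_opt
        /\ omega_S alpha beta rho tau_opt
           = if small_beta
             then (1 + Num.sqrt (1 - alpha * rho))
                  / (1 + Num.sqrt (1 - alpha * rho) + Num.sqrt (alpha * rho))
             else 2 / (2 + Num.sqrt (beta * rho)))].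
Proof.
move: rho_itv; rewrite in_itv/= => /andP[rho0 rho1].
have ar1 : alpha * rho <= 1.
  by rewrite -(ler_pM2l alpha_gt0) divff ?gt_eqF in rho1.
have B_mono := cocoercive_monotone (ltW beta_gt0) B_coco.
have wR1 (eta : R) : 0 < eta -> omega_R eta 0 tau = 1.
  move=> eta0; rewrite /omega_R !mulr0 !mul0r subr0 !addr0.
  by rewrite divff ?gt_eqF ?sqrtr1.
(* [B] is merely monotone: apply the strongly monotone rates with rho = 0 *)
have RB : 1.-lipschitz (reflected_resolvent (tau *: B)).
  rewrite -(wR1 beta)//; apply: reflected_resolvent_lipschitz => //.
  by rewrite mulr0.
have RA : (omega_R alpha rho tau).-lipschitz (reflected_resolvent (tau *: A)).
  by apply: reflected_resolvent_lipschitz => //; exact: ltW.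
have wR0 : 0 <= omega_R alpha rho tau by exact: sqrtr_ge0.
have RBA : (omega_R alpha rho tau).-lipschitz
    (peaceman_rachford (tau *: B) (tau *: A)).
  by apply: lipschitz_comp RB RA; rewrite ?mul1r.
have RAB : (omega_R alpha rho tau).-lipschitz
    (peaceman_rachford (tau *: A) (tau *: B)).
  by apply: lipschitz_comp RA RB; rewrite ?mulr1.
split.
- split; last exact: omega_G_opt.
  rewrite in_itv/= => tauI; split; last exact: omega_G_in01.
  exact: explicit_sum_lipschitz.
- split; last exact: omega_T1_opt.
  rewrite in_itv/= => tauI.
  have [T01 T01'] := omega_T1_in01 alpha_gt0 rho0 ar1 tauI.
  split=> //.
  have JB : 1.-lipschitz (resolvent (tau *: B)).
    have := resolvent_lipschitz dot_norm beta_gt0 (lexx 0) tau_gt0 B_coco.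
    by move=> /(_ B_mono); rewrite mulr0 addr0 divr1.
  apply: lipschitz_comp JB _; rewrite ?mul1r//.
  by apply: explicit_lipschitz => //; [exact: ltW|case/andP: tauI => _ /ltW].
- split; last exact: omega_T2_opt.
  rewrite in_itv/= => /andP[_ tau2]; split; last exact: omega_T2_in01.
  (* At [rho = 0] the rate [omega_T1] equals 1, and [tau <= 2 * beta] is the range in which the
     explicit step on [B] is nonexpansive. *)
  have GB : 1.-lipschitz (explicit_op (tau *: B)).
    have -> : 1 = omega_T1 beta 0 tau.
      by rewrite /omega_T1 mulr0 !mul0r subr0 sqrtr1.
    by apply: explicit_lipschitz => //; rewrite mulr0.
  have w0 : 0 <= omega_T2 rho tau by rewrite divr_ge0 ?addr_ge0 ?mulr_ge0// ltW.
  apply: lipschitz_comp w0 _ GB; rewrite ?mulr1//.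
  exact: resolvent_lipschitz (ltW rho0) _ A_coco A_smono.
- split; last exact: omega_R_opt.
  by have [] := omega_R_in01 alpha_gt0 rho0 ar1 tau_gt0.
split; last exact: omega_S_opt.
(* Averaging the identity with a Lipschitz map averages the constants; the minimum of two valid
   constants is one of them. *)
have S_lip (M N : H -> H) k :
    (omega_R alpha rho tau).-lipschitz (peaceman_rachford N M) ->
    k.-lipschitz (douglas_rachford N M) ->
    (Num.min ((1 + omega_R alpha rho tau) / 2) k).-lipschitz
      (douglas_rachford N M).
  move=> /lipschitzTP Rl /lipschitzTP Sl; apply/lipschitzTP => x y.
  rewrite minEle; case: ifP => // _.
  rewrite /douglas_rachford -scalerBr normrZ gtr0_norm//.
  rewrite mulrC mulrAC ler_pM2r//.
  by rewrite opprD addrACA (le_trans (ler_normD _ _))// mulrDl mul1r lerD2l.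
split; last exact: omega_S_in01.
- apply: S_lip => //.
  exact: (douglas_rachford_lipschitzl dot_norm alpha_gt0).
- apply: S_lip => //.
  exact: (douglas_rachford_lipschitzr dot_norm alpha_gt0).
Qed.
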